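(* Let $\mathbf E=(E,+,{}',0,1)$ be an effect algebra with induced order $\leq$ and let $a,b,c\in E$. Then: (i) $a\rightarrow b\subseteq U(a')$; (ii) if $a\leq b$ then $a\rightarrow b=U(a')$; (iii) if $b\leq a$ then $a\rightarrow b=[a',a'+b]$; (iv) $0\rightarrow b=\{1\}$; (v) $a\rightarrow 0=\{a'\}$; (vi) $1\rightarrow b=L(b)$; (vii) $L(a\rightarrow b)=L(a')$; (viii) $a\cdot(a\rightarrow b)=L(a,b)$; (ix) if $b\leq c$ then $a\rightarrow b\subseteq a\rightarrow c$; (x) $a\rightarrow b=(a\cdot(L(a,b))')'=(a\cdot U(a',b'))'$; (xi) $a\rightarrow b\leq U(a',c')$ if and only if $a\rightarrow c\leq U(a',b')$; (xii) if $\mathbf E$ is a lattice effect algebra then $a\rightarrow(a\wedge b)=a\rightarrow b$.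
   Context: An effect algebra is a partial algebra $(E,+,{}',0,1)$ of type $(2,1,0,0)$ where $+$ is a partial binary operation such that for all $x,y,z\in E$: (E1) $x+y$ is defined iff $y+x$ is defined, and then $x+y=y+x$; (E2) $(x+y)+z$ is defined iff $x+(y+z)$ is defined, and then they are equal; (E3) $x'$ is the unique $u\in E$ with $x+u=1$; (E4) if $1+x$ is defined then $x=0$. The induced order is $x\leq y$ iff $x+z=y$ for some $z\in E$; it makes $E$ a bounded poset, and $x+y$ is defined iff $x\leq y'$. A lattice effect algebra is one whose induced order is a lattice. For $A\subseteq E$, $L(A)=\{x\mid x\leq y\ \forall y\in A\}$, $U(A)=\{x\mid y\leq x\ \forall y\in A\}$; $L(a,b)=L(\{a,b\})$, $L(a)=L(\{a\})$, etc. $[a,b]=\{x\mid a\leq x\leq b\}$. For subsets $A,B$ and an element $x$: $A\leq B$ means $u\leq v$ for all $u\in A,v\in B$ (similarly $A\leq x$); $A'=\{u'\mid u\in A\}$; if $A\leq x'$ then $x+A=\{x+u\mid u\in A\}$. Define $x\cdot y:=(x'+y')'$, defined exactly when $x'\leq y$; for a set $A$ with $x'\leq A$, $x\cdot A=\{x\cdot u\mid u\in A\}$. Implication: $x\rightarrow y:=x'+L(x,y)$ (a subset of $E$). *)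

(* Defs.v *)
From HB Require Import structures.
From mathcomp Require Import all_boot all_order.
From mathcomp Require Import interval.
From mathcomp Require Import boolp classical_sets set_interval.

Set Implicit Arguments.
Unset Strict Implicit.
Unset Printing Implicit Defensive.

Local Open Scope classical_set_scope.
Local Open Scope order_scope.

(* Partial addition: [eadd x y = None] means that x + y is undefined, and
   equality in [option] is Kleene equality, i.e. both sides are undefined or
   both are defined and equal. *)
Record effectAlgebra := EffectAlgebra {
  esort :> Type;
  eadd : esort -> esort -> option esort;
  ecompl : esort -> esort;
  ezero : esort;
  eone : esort;
  eaddC : forall x y, eadd x y = eadd y x;
  eaddA : forall x y z,
    obind (eadd ^~ z) (eadd x y) = obind (eadd x) (eadd y z);
  ecomplP : forall x u, eadd x u = Some eone <-> u = ecompl x;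
  eadd1 : forall x, eadd eone x <> None -> x = ezero
}.

Arguments ezero {_}.
Arguments eone {_}.

Declare Scope effect_scope.
Delimit Scope effect_scope with EA.
Notation "x ^'" := (ecompl x) : effect_scope.
Notation "0" := ezero : effect_scope.
Notation "1" := eone : effect_scope.
Local Open Scope effect_scope.

Section InducedOrder.
Variable E : effectAlgebra.
Implicit Types x y z : E.

Definition ele x y : bool := `[< exists z, eadd x z = Some y >].

Lemma eleP x y : reflect (exists z, eadd x z = Some y) (ele x y).
Proof. exact: asboolP. Qed.

Lemma eadd_compl x : eadd x x^' = Some (1 : E).
Proof. exact/ecomplP. Qed.

Lemma ecomplK x : x^'^' = x.
Proof. by apply/esym/ecomplP; rewrite eaddC; exact: eadd_compl. Qed.

Lemma eadd10 : eadd (1 : E) 0 = Some (1 : E).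
Proof.
have h := eadd_compl (1 : E).
have e : (1 : E)^' = 0 by apply: eadd1; rewrite h.
by rewrite -{1}e.
Qed.

Lemma eaddx0 x : eadd x 0 = Some x.
Proof.
rewrite -(ecomplK x); set y := x^'.
have := eaddA y y^' 0; rewrite eadd_compl /= eadd10.
case: (eadd y^' 0) => [u|] //= /esym/ecomplP ->.
by [].
Qed.

Lemma eadd_eqr x t : eadd x t = Some x -> t = 0.
Proof.
move=> h; have := eaddA t x x^'.
rewrite (eaddC t x) h /= !eadd_compl /= => /esym h1.
by apply: eadd1; rewrite eaddC h1.
Qed.

Lemma eadd_eq0 z w : eadd z w = Some (0 : E) -> z = 0.
Proof.
move=> h; have := eaddA (1 : E) z w; rewrite h /= eadd10.
by case E1 : (eadd (1 : E) z) => [u|] //= _; apply: eadd1; rewrite E1.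
Qed.

Lemma ele_refl : reflexive ele.
Proof. by move=> x; apply/eleP; exists 0; exact: eaddx0. Qed.

Lemma ele_anti : antisymmetric ele.
Proof.
move=> x y /andP[/eleP[z xz] /eleP[w yw]].
have := eaddA x z w; rewrite xz /= yw.
case zw : (eadd z w) => [t|] //= /esym /eadd_eqr t0.
move: zw; rewrite t0 => /eadd_eq0 z0.
by move: xz; rewrite z0 eaddx0 => -[].
Qed.

Lemma ele_trans : transitive ele.
Proof.
move=> y x z /eleP[u xu] /eleP[v yv].
have := eaddA x u v; rewrite xu /= yv.
by case: (eadd u v) => [t|] //= /esym h; apply/eleP; exists t.
Qed.

End InducedOrder.

Fact effect_display : Order.disp_t. Proof. exact: (Order.Disp tt tt). Qed.

(* The carrier is an arbitrary type: its eqType and choiceType structures, on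
   which porderType is built, are the classical ones. *)
HB.instance Definition _ (E : effectAlgebra) := gen_eqMixin (esort E).
HB.instance Definition _ (E : effectAlgebra) := gen_choiceMixin (esort E).
HB.instance Definition _ (E : effectAlgebra) :=
  Order.Le_isPOrder.Build effect_display (esort E)
    (@ele_refl E) (@ele_anti E) (@ele_trans E).

Lemma effect_leP (E : effectAlgebra) (x y : E) :
  x <= y <-> exists z, eadd x z = Some y.
Proof. by split=> [/eleP//|?]; apply/eleP. Qed.

(* L(A) is [lbound A] and U(A) is [ubound A]. *)

Definition emul (E : effectAlgebra) (x y : E) : option E :=
  omap (@ecompl E) (eadd x^' y^').

Definition setle (E : effectAlgebra) (A B : set E) : Prop :=
  forall u v, A u -> B v -> u <= v.

(* x + A and x . A drop the undefined terms; they denote the intended sets only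
   when [setle A [set x^']], resp. [setle [set x^'] A]. *)
Definition eadd_set (E : effectAlgebra) (x : E) (A : set E) : set E :=
  [set y | exists2 u, A u & eadd x u = Some y].

Definition emul_set (E : effectAlgebra) (x : E) (A : set E) : set E :=
  [set y | exists2 u, A u & emul x u = Some y].

Definition ecompl_set (E : effectAlgebra) (A : set E) : set E :=
  @ecompl E @` A.

Definition eimpl (E : effectAlgebra) (x y : E) : set E :=
  eadd_set x^' (lbound [set x; y]).

Lemma eimpl_defined (E : effectAlgebra) (x y : E) :
  setle (lbound [set x; y]) [set x^'^'].
Proof. by move=> u _ Lu ->; rewrite ecomplK; apply: Lu; left. Qed.

(* The set of infima (suprema) of a pair has at most one element. *)
Definition is_lattice (E : effectAlgebra) : Prop :=
  forall x y : E,
    infimums [set x; y] !=set0 /\ supremums [set x; y] !=set0.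

(* Main.v *)
Require Import Defs.
From mathcomp Require Import all_boot all_order.
From mathcomp Require Import interval.
From mathcomp Require Import boolp classical_sets set_interval.

Set Implicit Arguments.
Unset Strict Implicit.
Unset Printing Implicit Defensive.

Import Order.LTheory.

Local Open Scope classical_set_scope.
Local Open Scope order_scope.
Local Open Scope effect_scope.

(** Everything rests on residuation, [eadd_residual]: if x + y = s then x + s' = y'. It makes
    complementation an antitone involution, shows that x + y is defined iff y <= x'
    ([eadd_definedP]), and makes addition of a fixed element order-reflecting ([eadd_le_cancel]). So
    u |-> a' + u is an order isomorphism from [0,a] onto [a',1], with inverse s |-> a . s, and
    [eimpl a b] is the image of L(a,b) under it. Most clauses are read off from this picture; (x)
    adds De Morgan duality, and (xi) the symmetry in u and w of the condition that a' + u + w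
    exists. *)

Section EffectAlgebraTheory.
Variable E : effectAlgebra.
Implicit Types a b c s t u v w x y z : E.

(** Reassociating 1 = (y + x) + s' as y + (x + s') exhibits x + s' as the unique complement of y. *)
Lemma eadd_residual x y s : eadd x y = Some s -> eadd x s^' = Some y^'.
Proof.
rewrite eaddC => xy; have := eaddA y x s^'; rewrite xy /= eadd_compl.
by case: (eadd x s^') => //= r /esym/ecomplP ->.
Qed.

Lemma ecompl0 : (0 : E)^' = 1.
Proof. by apply/esym/ecomplP; rewrite eaddC eaddx0. Qed.

Lemma ecompl1 : (1 : E)^' = 0.
Proof. by rewrite -ecompl0 ecomplK. Qed.

Lemma eadd0x x : eadd 0 x = Some x.
Proof. by rewrite eaddC eaddx0. Qed.

Lemma effect_le0x x : 0 <= x.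
Proof. by apply/effect_leP; exists x; exact: eadd0x. Qed.

Lemma effect_lex1 x : x <= 1.
Proof. by apply/effect_leP; exists x^'; exact: eadd_compl. Qed.

Lemma effect_lex0 x : x <= 0 -> x = 0.
Proof. by move=> x0; apply/le_anti; rewrite x0 effect_le0x. Qed.

Lemma ecompl_le x y : x <= y -> y^' <= x^'.
Proof.
move=> /effect_leP[z]; rewrite eaddC => /eadd_residual.
by rewrite eaddC => zy; apply/effect_leP; exists z.
Qed.

Lemma ecompl_leC x y : x <= y^' -> y <= x^'.
Proof. by move/ecompl_le; rewrite ecomplK. Qed.

Lemma ecompl_leCl x y : x^' <= y -> y^' <= x.
Proof. by move/ecompl_le; rewrite ecomplK. Qed.

Lemma eadd_definedP x y : (exists s, eadd x y = Some s) <-> y <= x^'.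
Proof.
split=> [[s /eadd_residual xs]|/effect_leP[z /eadd_residual]].
  by apply: ecompl_leC; apply/effect_leP; exists s^'.
by rewrite ecomplK eaddC => yx; exists z^'.
Qed.

Lemma eadd_le_mono x u v s t :
  eadd x u = Some s -> eadd x v = Some t -> u <= v -> s <= t.
Proof.
move=> xu xv /effect_leP[w uw]; apply/effect_leP; exists w.
by have := eaddA x u w; rewrite xu uw /= xv.
Qed.

(** By residuation u' = x + s' and v' = x + t', so this is monotonicity of addition applied to t' <=
    s'. *)
Lemma eadd_le_cancel x u v s t :
  eadd x u = Some s -> eadd x v = Some t -> s <= t -> u <= v.
Proof.
move=> /eadd_residual xs /eadd_residual xt /ecompl_le st.
by rewrite -(ecomplK u); apply: ecompl_leCl; apply: eadd_le_mono xt xs st.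
Qed.

Lemma lbound2P x y z : lbound [set x; y] z <-> z <= x /\ z <= y.
Proof.
split=> [h|[zx zy] _ [->|->]//].
by split; apply: h; [left|right].
Qed.

Lemma ubound2P x y z : ubound [set x; y] z <-> x <= z /\ y <= z.
Proof.
split=> [h|[xz yz] _ [->|->]//].
by split; apply: h; [left|right].
Qed.

Lemma lbound_set1P x z : lbound [set x] z <-> z <= x.
Proof. by split=> [h|zx _ ->//]; apply: h. Qed.

Lemma ubound_set1P x z : ubound [set x] z <-> x <= z.
Proof. by split=> [h|xz _ ->//]; apply: h. Qed.

Lemma eimplP a b s :
  eimpl a b s <-> exists u, [/\ u <= a, u <= b & eadd a^' u = Some s].
Proof.
split=> [[u /lbound2P[ua ub] us]|[u [ua ub us]]]; first by exists u.
by exists u => //; apply/lbound2P.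
Qed.

Lemma eimpl_ge a b s : eimpl a b s -> a^' <= s.
Proof. by move=> /eimplP[u [_ _ us]]; apply/effect_leP; exists u. Qed.

Lemma eimpl_compl a b : eimpl a b a^'.
Proof.
apply/eimplP; exists 0; rewrite eaddx0.
by split=> //; exact: effect_le0x.
Qed.

Lemma eimpl_lbound a b c :
  lbound [set a; b] = lbound [set a; c] -> eimpl a b = eimpl a c.
Proof. by rewrite /eimpl => ->. Qed.

Lemma eimpl_mono a b c : b <= c -> eimpl a b `<=` eimpl a c.
Proof.
move=> bc s /eimplP[u [ua ub us]]; apply/eimplP.
by exists u; split=> //; apply: le_trans bc.
Qed.

Lemma eimpl_of_le a b : a <= b -> eimpl a b = ubound [set a^'].
Proof.
move=> ab; apply/seteqP; split=> s.
  by move=> /eimpl_ge ?; apply/ubound_set1P.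
move=> /ubound_set1P /effect_leP[u us]; apply/eimplP; exists u.
(* The bound u <= a comes from the mere existence of a' + u. *)
have ua : u <= a by rewrite -(ecomplK a); apply/eadd_definedP; exists s.
by split=> //; apply: le_trans ab.
Qed.

Lemma eimpl_of_ge a b : b <= a ->
  exists2 s : E, eadd a^' b = Some s & eimpl a b = `[a^', s]%classic.
Proof.
move=> ba; have /eadd_definedP[s abs] : b <= a^'^' by rewrite ecomplK.
exists s => //; apply/seteqP; split=> t /=.
  move=> iabt; have /eimplP[u [_ ub ut]] := iabt.
  by rewrite in_itv /= (eimpl_ge iabt); apply: eadd_le_mono ut abs ub.
rewrite in_itv /= => /andP[/effect_leP[u ut] ts].
have ub := eadd_le_cancel ut abs ts.
by apply/eimplP; exists u; split=> //; apply: le_trans ba.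
Qed.

Lemma eimpl0x b : eimpl 0 b = [set 1].
Proof.
apply/seteqP; split=> s; last by move=> ->; rewrite -ecompl0; exact: eimpl_compl.
by move=> /eimpl_ge; rewrite ecompl0 => s1; apply/le_anti; rewrite s1 effect_lex1.
Qed.

Lemma eimplx0 a : eimpl a 0 = [set a^'].
Proof.
apply/seteqP; split=> s; last by move=> ->; exact: eimpl_compl.
by move=> /eimplP[u [_ /effect_lex0 ->]]; rewrite eaddx0 => -[].
Qed.

Lemma eimpl1x b : eimpl 1 b = lbound [set b].
Proof.
apply/seteqP; split=> s.
  move=> /eimplP[u [_ ub]]; rewrite ecompl1 eadd0x => -[<-].
  exact/lbound_set1P.
move=> /lbound_set1P sb; apply/eimplP; exists s.
by split=> //; [exact: effect_lex1|rewrite ecompl1 eadd0x].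
Qed.

(** The least element of [eimpl a b] is a', attained at u = 0. *)
Lemma lbound_eimpl a b : lbound (eimpl a b) = lbound [set a^'].
Proof.
apply/seteqP; split=> z; first by move=> h; apply/lbound_set1P/h/eimpl_compl.
by move=> /lbound_set1P za s /eimpl_ge; apply: le_trans.
Qed.

(** Multiplication by a undoes addition of a': residuation gives a' + s' = u'. *)
Lemma emul_eadd a u s : eadd a^' u = Some s -> emul a s = Some u.
Proof. by rewrite /emul => /eadd_residual -> /=; rewrite ecomplK. Qed.

Lemma emul_ecompl a u : emul a u^' = omap (@ecompl E) (eadd a^' u).
Proof. by rewrite /emul ecomplK. Qed.

Lemma emul_set_eimpl a b : emul_set a (eimpl a b) = lbound [set a; b].
Proof.
apply/seteqP; split=> u.
  move=> [s /eimplP[v [va vb /emul_eadd ->]]] [<-].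
  exact/lbound2P.
move=> /lbound2P[ua ub].
have /eadd_definedP[s aus] : u <= a^'^' by rewrite ecomplK.
by exists s; [apply/eimplP; exists u|exact: emul_eadd].
Qed.

Lemma ecompl_set_lbound2 a b :
  ecompl_set (lbound [set a; b]) = ubound [set a^'; b^'].
Proof.
apply/seteqP; split=> v.
  by move=> [u /lbound2P[ua ub] <-]; apply/ubound2P; split; exact: ecompl_le.
move=> /ubound2P[av bv]; exists v^'; last exact: ecomplK.
by apply/lbound2P; split; exact: ecompl_leCl.
Qed.

(** Since a . u' = (a' + u)', both sides drop exactly the same undefined terms, so A may be
    arbitrary. *)
Lemma ecompl_emul_set a (A : set E) :
  ecompl_set (emul_set a (ecompl_set A)) = eadd_set a^' A.
Proof.
apply/seteqP; split=> s.
  move=> [v [_ [u Au <-] auv] <-]; move: auv; rewrite emul_ecompl.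
  by case aus: eadd => [t|] //= [<-]; exists u; rewrite ?ecomplK.
move=> [u Au aus]; exists s^'; last exact: ecomplK.
by exists u^'; [exists u|rewrite emul_ecompl aus].
Qed.

(* For u in L(a,b) and w in L(a,c), both [a' + u <= w'] and [a' + w <= u'] say
   that a' + u + w is defined. *)
Lemma eimpl_le_exchange a b c :
  setle (eimpl a b) (ubound [set a^'; c^']) ->
  setle (eimpl a c) (ubound [set a^'; b^']).
Proof.
move=> h t v /eimplP[w [wa wc awt]] /ubound2P[av bv].
have va := ecompl_leCl av; have vb := ecompl_leCl bv.
have /eadd_definedP[s avs] : v^' <= a^'^' by rewrite ecomplK.
have sw : s <= w^'.
  apply: h; first by apply/eimplP; exists v^'.
  by apply/ubound2P; split; exact: ecompl_le.
have /eadd_definedP[r swr] := ecompl_leC sw.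
rewrite -(ecomplK v); apply: ecompl_leC; apply/eadd_definedP; exists r.
(* With t = w + a' and s = a' + v', associativity turns the defined sum w + s into t + v', whose
   existence means t <= v. *)
have := eaddA w a^' v^'; rewrite (eaddC w) awt avs /= => ->.
by rewrite eaddC.
Qed.

(** The implication depends on its second argument only through the lower bounds shared with a, and
    m leaves these unchanged. *)
Lemma infimum_lbound a b m :
  infimums [set a; b] m -> lbound [set a; m] = lbound [set a; b].
Proof.
move=> [/lbound2P[ma mb] m_max]; apply/seteqP; split=> z /lbound2P[za zm].
  by apply/lbound2P; split=> //; apply: le_trans mb.
by apply/lbound2P; split=> //; apply: m_max; apply/lbound2P.
Qed.

End EffectAlgebraTheory.

Theorem theorem4 (E : effectAlgebra) (a b c : E) :
  (* (i) *)
  (eimpl a b `<=` ubound [set a^']) /\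
  (* (ii) *)
  (a <= b -> eimpl a b = ubound [set a^']) /\
  (* (iii), including that a' + b is defined *)
  (b <= a ->
     exists2 s : E, eadd a^' b = Some s & eimpl a b = `[a^', s]%classic) /\
  (* (iv) *)
  (eimpl 0 b = [set 1]) /\
  (* (v) *)
  (eimpl a 0 = [set a^']) /\
  (* (vi) *)
  (eimpl 1 b = lbound [set b]) /\
  (* (vii) *)
  (lbound (eimpl a b) = lbound [set a^']) /\
  (* (viii), including that the product is defined *)
  (setle [set a^'] (eimpl a b) /\
   emul_set a (eimpl a b) = lbound [set a; b]) /\
  (* (ix) *)
  (b <= c -> eimpl a b `<=` eimpl a c) /\
  (* (x), including that both products are defined *)
  ((setle [set a^'] (ecompl_set (lbound [set a; b])) /\
    eimpl a b =
      ecompl_set (emul_set a (ecompl_set (lbound [set a; b])))) /\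
   (setle [set a^'] (ubound [set a^'; b^']) /\
    eimpl a b = ecompl_set (emul_set a (ubound [set a^'; b^'])))) /\
  (* (xi) *)
  (setle (eimpl a b) (ubound [set a^'; c^']) <->
   setle (eimpl a c) (ubound [set a^'; b^'])) /\
  (* (xii), m being the meet of a and b *)
  (is_lattice E ->
     forall m : E, infimums [set a; b] m -> eimpl a m = eimpl a b).
Proof.
have ub2_ge x y : setle [set x] (ubound [set x; y]).
  by move=> _ v -> /ubound2P[].
split; first by move=> s /eimpl_ge ?; apply/ubound_set1P.
split; first exact: eimpl_of_le.
split; first exact: eimpl_of_ge.
split; first exact: eimpl0x.
split; first exact: eimplx0.
split; first exact: eimpl1x.
split; first exact: lbound_eimpl.
split.
  by split; [move=> _ s -> /eimpl_ge|exact: emul_set_eimpl].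
split; first exact: eimpl_mono.
split.
  (* As U(a',b') is the set of complements of L(a,b), both products coincide, and complementing them
     gives a' + L(a,b), the definition of [eimpl a b]. *)
  rewrite -ecompl_set_lbound2 ecompl_emul_set.
  by split; split=> //; rewrite ecompl_set_lbound2; exact: ub2_ge.
split; first by split; exact: eimpl_le_exchange.
by move=> _ m /infimum_lbound; exact: eimpl_lbound.
Qed.
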